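(* Let $n\ge 2$, let $G$ be a domain in $\mathbb R^n$, let $F\in C^n(G)$ be real-valued, and let $x_0\in G$ be such that $\{x_0\}$ is a connected component of the level set $F^{-1}(F(x_0))$. Then $x_0$ is Lyapunov stable for the gradient system of $F$ on $G$ or for the gradient system of $-F$ on $G$.
   Context: A domain is a nonempty connected open set. The gradient system of a function $F$ on $G$ is $\frac{dx}{dt}=-\operatorname{grad}F(x)$, where $\operatorname{grad}F(x)=\left(\frac{\partial F}{\partial x_1},\dots,\frac{\partial F}{\partial x_n}\right)^T$. Lyapunov stability: an equilibrium $x_0$ of a system $dx/dt=f(x)$ is Lyapunov stable if for every $\epsilon>0$ there is $\delta>0$ such that, whenever $\|p-x_0\|<\delta$, the solution $x_p(t)$ with $x_p(0)=p$ satisfies $\|x_p(t)-x_0\|<\epsilon$ for every $t\ge0$. *)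

(* Defs.v *)
From HB Require Import structures.
From mathcomp Require Import all_boot all_order all_algebra.
From mathcomp Require Import all_classical all_reals all_analysis.

Set Implicit Arguments.
Unset Strict Implicit.
Unset Printing Implicit Defensive.

Import Order.TTheory GRing.Theory Num.Theory.
Import numFieldNormedType.Exports.

Local Open Scope classical_set_scope.
Local Open Scope ring_scope.

(* Functions and vector fields on G are represented by total functions on R^n;
   all the notions below only depend on their values on the open set G. *)

Definition domain (R : realType) (n : nat) (G : set 'cV[R]_n) : Prop :=
  [/\ G !=set0, open G & connected G].

(* The library norm on 'cV[R]_n is the sup norm. *)
Definition enorm (R : realType) (n : nat) (v : 'cV[R]_n) : R :=
  Num.sqrt (\sum_(i < n) v i 0 ^+ 2).

Definition partial (R : realType) (n : nat) (i : 'I_n) (F : 'cV[R]_n -> R) :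
    'cV[R]_n -> R :=
  fun x => 'D_(delta_mx i 0) F x.

Definition grad (R : realType) (n : nat) (F : 'cV[R]_n -> R) (x : 'cV[R]_n) :
    'cV[R]_n :=
  \col_(i < n) partial i F x.

Fixpoint Ck (R : realType) (n : nat) (G : set 'cV[R]_n) (k : nat)
    (F : 'cV[R]_n -> R) : Prop :=
  (forall x, G x -> {for x, continuous F}) /\
  if k is k'.+1 then
    forall i : 'I_n,
      (forall x, G x -> derivable F x (delta_mx i 0)) /\ Ck G k' (partial i F)
  else True.

(* Solution on [0, +oo[ of dx/dt = f(x) on G; the derivative is two-sided for
   t > 0 and one-sided at t = 0. *)
Definition solution (R : realType) (n : nat) (G : set 'cV[R]_n)
    (f : 'cV[R]_n -> 'cV[R]_n) (x : R -> 'cV[R]_n) : Prop :=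
  forall t : R, 0 <= t ->
    G (x t) /\
    (s - t)^-1 *: (x s - x t) @[s --> within [set s : R | 0 <= s] t^']
      --> f (x t).

Definition equilibrium (R : realType) (n : nat) (G : set 'cV[R]_n)
    (f : 'cV[R]_n -> 'cV[R]_n) (x0 : 'cV[R]_n) : Prop :=
  G x0 /\ f x0 = 0.

(* The global existence of the solution starting at p is part of the notion.
   For locally Lipschitz f this solution is unique; in general the bound is
   required of every solution. *)
Definition lyapunov_stable (R : realType) (n : nat) (G : set 'cV[R]_n)
    (f : 'cV[R]_n -> 'cV[R]_n) (x0 : 'cV[R]_n) : Prop :=
  equilibrium G f x0 /\
  forall eps : R, 0 < eps -> exists2 delta : R, 0 < delta &
    forall p : 'cV[R]_n, enorm (p - x0) < delta ->
      (exists2 x : R -> 'cV[R]_n, solution G f x & x 0 = p) /\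
      (forall x : R -> 'cV[R]_n, solution G f x -> x 0 = p ->
         forall t : R, 0 <= t -> enorm (x t - x0) < eps).

Definition gradient_system (R : realType) (n : nat) (F : 'cV[R]_n -> R) :
    'cV[R]_n -> 'cV[R]_n :=
  fun x => - grad F x.

(* Main.v *)
(* The level set through x0, cut down to a small closed ball, is compact, so the
   component {x0} is the intersection of the eta-chain components of x0, and one
   of these is contained in a prescribed small ball.  A neighbourhood U of it has
   F - F(x0) bounded away from 0 near its boundary, but with both signs possible.
   For points x, y at distance less than d let c(x, y) be 1 if exactly one of
   them is in U and F(x) < F(x0), and 0 otherwise.  This is a cocycle mod 2 on
   close triples, hence c = ds for a function s on the ball.  The sets
   {s = s(x0)} and {s + 1_U = s(x0) + 1} have boundaries where F < F(x0),
   resp. F > F(x0), only.  Both s and s + 1_U are constant on a spherical shell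
   (connected since n >= 2) around U, and they coincide there, while they differ
   at x0; so one of the two sets avoids the shell.  Say it is the second: then a
   solution of dx/dt = - grad F(x) starting near x0 cannot cross its boundary,
   because F decreases along solutions.  One of the two signs occurs for
   arbitrarily small balls. *)
Require Import Defs.
From HB Require Import structures.
From mathcomp Require Import all_boot all_order all_algebra.
From mathcomp Require Import all_classical all_reals all_analysis.
From mathcomp Require Import ring lra.

Set Implicit Arguments.
Unset Strict Implicit.
Unset Printing Implicit Defensive.

Import Order.TTheory GRing.Theory Num.Theory.
Import numFieldNormedType.Exports.

Local Open Scope classical_set_scope.
Local Open Scope ring_scope.

(** * Compactness and chain components *)

Lemma norm_triangle (R : realType) (V : normedModType R) (y x z : V) :
  `|x - z| <= `|x - y| + `|y - z|.
Proof. by rewrite -[x in leLHS](subrK y) -addrA ler_normD. Qed.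

Lemma continuous_dist (R : realType) (V : normedModType R) (a : V) :
  continuous (fun x : V => `|x - a|).
Proof.
move=> x; apply: cvg_norm; apply: cvgB; [exact: cvg_id|exact: cvg_cst].
Qed.

Lemma closed_far (R : realType) (V : normedModType R) (B : set V) (e : R) :
  closed [set z | forall a, B a -> e <= `|z - a|].
Proof.
have -> : [set z | forall a, B a -> e <= `|z - a|] =
    \bigcap_(a in B) [set z | e <= `|z - a|].
  by rewrite predeqE => z; split=> H a /H.
apply: closed_bigI => a _.
apply: (@preimage_closed _ _ (fun z : V => `|z - a| : R) [set t | e <= t]).
  by move=> z _; exact: continuous_dist.
exact: closed_ge.
Qed.

(** Continuity at the points of [K] is meant in the whole space, so [y] may leave [K]; near-covering
    compactness makes the radius uniform. *)
Lemma compact_uniform_continuity (R : realType) (V W : normedModType R)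
    (K : set V) (g : V -> W) (e : R) :
  compact K -> (forall x, K x -> {for x, continuous g}) -> 0 < e ->
  exists2 d, 0 < d & forall x y, K x -> `|x - y| < d -> `|g x - g y| < e.
Proof.
move=> /compact_near_coveringP cK cg e0.
have /cK : forall x, K x -> \forall x' \near x & d \near (0:R)^'+,
    forall y, `|x' - y| < d -> `|g x' - g y| < e.
  move=> x Kx; have e20 : 0 < e / 2 by rewrite divr_gt0.
  have /cvgrPdist_lt/(_ _ e20) := cg x Kx.
  move=> /nbhs_ballP[r /= r0 xr].
  have r20 : 0 < r / 2 by rewrite divr_gt0.
  exists (ball x (r / 2), [set d | d < r / 2]).
    by split => /=; [exact: nbhsx_ballx|exact: nbhs_right_lt].
  move=> -[x' d] /= [+ dr] y x'y; rewrite -ball_normE /= => xx'.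
  have /= h1 : `|g x - g x'| < e / 2.
    apply: xr; rewrite -ball_normE /=; lra.
  have /= h2 : `|g x - g y| < e / 2.
    apply: xr; rewrite -ball_normE /=.
    have := norm_triangle x' x y; lra.
  have := norm_triangle (g x) (g x') (g y); rewrite (distrC (g x') (g x)); lra.
move=> H; near (0:R)^'+ => d; exists d => // x y Kx.
have := near H d; apply => //.
Unshelve. all: by end_near. Qed.

Lemma compact_lower_bound (R : realType) (V : normedModType R)
    (K : set V) (g : V -> R) :
  compact K -> (forall x, K x -> {for x, continuous g}) ->
  (forall x, K x -> 0 < g x) ->
  exists2 m, 0 < m & forall x, K x -> m <= g x.
Proof.
move=> /compact_near_coveringP cK cg gpos.
have /cK : forall x, K x -> \forall x' \near x & m \near (0:R)^'+, m <= g x'.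
  move=> x Kx; have gx := gpos x Kx.
  have e20 : 0 < g x / 2 by rewrite divr_gt0.
  have /cvgrPdist_lt/(_ _ e20) H := cg x Kx.
  exists ([set x' | `|g x - g x'| < g x / 2], [set d | d < g x / 2]).
    by split => //=; exact: nbhs_right_lt.
  move=> -[x' d] /= []; rewrite ltr_norml => /andP[_ ? ?]; lra.
move=> H; near (0:R)^'+ => d; exists d => // x Kx.
have := near H d; apply => //.
Unshelve. all: by end_near. Qed.

Lemma compact_closed_ball (R : realType) (n : nat) (a : 'cV[R]_n) (r : R) :
  compact [set x | `|x - a| <= r].
Proof.
have cI := @rV_compact R n (fun i => `[a i ord0 - r, a i ord0 + r]%classic)
  (fun=> @segment_compact _ _ _).
have ct : continuous (fun v : 'rV[R]_n => v^T).
  move=> v A /nbhs_ballP[e /= e0 eA]; apply/nbhs_ballP; exists e => // w [_ vw].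
  by apply: eA; split => // i j; rewrite !mxE; exact: vw.
have := @continuous_compact _ _ (fun v : 'rV[R]_n => v^T) _
  (continuous_subspaceT ct) cI.
move=> cc; apply: (subclosed_compact _ cc).
  apply: (@preimage_closed _ _ (fun z : 'cV[R]_n => `|z - a| : R) [set t | t <= r]).
    by move=> z _; exact: continuous_dist.
  exact: closed_le.
move=> x /= xr; exists x^T; last by rewrite trmxK.
move=> i /=; rewrite in_itv /= mxE.
have : `|(x - a) i ord0| <= r.
  apply: le_trans xr; rewrite [leRHS]/Num.norm /= mx_normrE.
  by apply: (le_bigmax _ (fun ij => `|(x - a) ij.1 ij.2|) (i, ord0)).
rewrite !mxE ler_norml => /andP[? ?]; apply/andP; split; lra.
Qed.

(** The [eta]-chain component of [x0] in [Z]: finite chains with jumps shorter than [eta]. *)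
Inductive reach (R : realType) (V : normedModType R) (Z : set V) (x0 : V)
    (eta : R) : V -> Prop :=
| reach_refl : reach Z x0 eta x0
| reach_step x y : reach Z x0 eta x -> Z y -> `|x - y| < eta ->
    reach Z x0 eta y.

Section chains.
Context (R : realType) (V : normedModType R) (Z : set V) (x0 : V).
Hypotheses (cZ : compact Z) (Zx0 : Z x0).

Lemma reach_mem eta x : reach Z x0 eta x -> Z x.
Proof. by case. Qed.

Lemma reach_le eta eta' x : eta <= eta' -> reach Z x0 eta x -> reach Z x0 eta' x.
Proof.
move=> le; elim=> [|{}x y _ IH Zy xy]; first exact: reach_refl.
by apply: reach_step IH Zy _; exact: lt_le_trans le.
Qed.

(** Not being reached is an open condition: if a point close to [x] were reached with a smaller
    [eta], one more jump would reach [x]. Compactness then gives a common [eta]. *)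
Lemma reach_compact_avoid (T : set V) : compact T -> T `<=` Z ->
  (forall x, T x -> exists2 eta, 0 < eta & ~ reach Z x0 eta x) ->
  exists2 eta, 0 < eta & forall x, T x -> ~ reach Z x0 eta x.
Proof.
move=> /compact_near_coveringP cT TZ av.
have /cT : forall x, T x -> \forall x' \near x & eta \near (0:R)^'+,
    ~ reach Z x0 eta x'.
  move=> x Tx; have [d d0 nd] := av x Tx.
  exists (ball x d, [set eta | eta < d]).
    by split => /=; [exact: nbhsx_ballx|exact: nbhs_right_lt].
  move=> -[x' eta] /= [+ etad]; rewrite -ball_normE /= distrC => x'x rx'.
  by apply/nd/(reach_step _ (TZ _ Tx) x'x)/reach_le/rx'/ltW.
move=> H; near (0:R)^'+ => d; exists d => // x Tx.
have := near H d; apply => //.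
Unshelve. all: by end_near. Qed.

(** For compact [Z] this intersection of chain components is the connected component of [x0]; what
    is used is that it is connected. *)
Definition quasi_component := [set x | forall eta, 0 < eta -> reach Z x0 eta x].

Lemma quasi_component_closed : closed quasi_component.
Proof.
move=> z zQ eta eta0.
have clZ : closed Z by apply: compact_closed => //; exact: norm_hausdorff.
have Zz : Z z.
  by apply: clZ => B /zQ[q [Qq Bq]]; exists q; split=> //; exact: reach_mem (Qq 1 ltr01).
have [q [Qq]] := zQ _ (nbhsx_ballx z eta eta0).
rewrite -ball_normE /= distrC => qz.
exact: reach_step (Qq _ eta0) Zz qz.
Qed.

Lemma compact_disjoint_dist (A B : set V) : compact A -> closed B ->
  A `&` B = set0 ->
  exists2 e, 0 < e & forall a b, A a -> B b -> e <= `|a - b|.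
Proof.
move=> /compact_near_coveringP cA cB AB.
have /cA : forall x, A x -> \forall x' \near x & e \near (0:R)^'+,
    forall b, B b -> e <= `|x' - b|.
  move=> x Ax.
  have : nbhs x (~` B).
    apply: open_nbhs_nbhs; split; first exact: closed_openC.
    by move=> Bx; rewrite -[False]/(set0 x) -AB.
  move=> /nbhs_ballP[d /= d0 dB].
  have d20 : 0 < d / 2 by rewrite divr_gt0.
  exists (ball x (d / 2), [set eta | eta < d / 2]).
    by split => /=; [exact: nbhsx_ballx|exact: nbhs_right_lt].
  move=> -[x' e] /= [+ ed] b Bb; rewrite -ball_normE /= => xx'.
  rewrite leNgt; apply/negP => x'b; apply: (dB b) => //.
  rewrite -ball_normE /=; have := norm_triangle x' x b; lra.
move=> H; near (0:R)^'+ => d; exists d => // a b Aa Bb.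
have := near H d; apply => //.
Unshelve. all: by end_near. Qed.

(** [A] and [B] are at positive distance [e]. The points of [Z] at distance at least [e / 3] from
    both are missed by all sufficiently fine chains, and a jump below [e / 3] cannot pass from the
    [e / 3]-neighbourhood of [A] to a point that close to [B]. So fine chains from [x0] stay near
    [A]. *)
Lemma quasi_component_split (A B : set V) : closed A -> closed B ->
  A `|` B = quasi_component -> A `&` B = set0 -> A x0 -> B = set0.
Proof.
move=> clA clB ABQ AB Ax0.
have AZ : A `<=` Z.
  move=> x Ax; apply: (@reach_mem 1).
  by have : quasi_component x by [rewrite -ABQ; left]; apply.
have cA : compact A by exact: subclosed_compact clA cZ AZ.
have [e e0 eAB] := compact_disjoint_dist cA clB AB.
have e30 : 0 < e / 3 by rewrite divr_gt0.
pose T := Z `&` ([set z | forall a, A a -> e / 3 <= `|z - a|] `&`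
                 [set z | forall a, B a -> e / 3 <= `|z - a|]).
have cT : compact T.
  by apply: compact_closedI => //; apply: closedI; exact: closed_far.
have [|x [Zx [xA xB]]|eta eta0 av] := @reach_compact_avoid _ cT.
- by move=> x [].
- have : ~ quasi_component x.
    rewrite -ABQ => -[/xA|/xB]; rewrite subrr normr0; lra.
  by move=> /existsNP[d /not_implyP[]]; exists d.
have near_A x : reach Z x0 (Num.min eta (e / 3)) x ->
    exists2 a, A a & `|x - a| < e / 3.
  elim=> [|{}x y rx [a Aa xa] Zy xy].
    by exists x0 => //; rewrite subrr normr0.
  have ry : reach Z x0 eta y.
    by apply: (@reach_le (Num.min eta (e / 3))); [rewrite ge_min lexx|
      exact: reach_step rx Zy xy].
  apply: contrapT => nA; apply: (av y) => //; split => //; split=> b Ab /=.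
    by rewrite leNgt; apply/negP => ?; apply: nA; exists b.
  rewrite leNgt; apply/negP => yb; have := eAB _ _ Aa Ab.
  move: xy; rewrite lt_min => /andP[_ xy].
  have := norm_triangle x a b; have := norm_triangle y x b.
  by rewrite (distrC a x); lra.
rewrite -subset0 => b Bb.
have m0 : 0 < Num.min eta (e / 3) by rewrite lt_min eta0.
have /(_ _ m0)/near_A[a Aa] : quasi_component b by rewrite -ABQ; right.
by have := eAB _ _ Aa Bb; rewrite distrC; lra.
Qed.

Lemma quasi_component_connected : connected quasi_component.
Proof.
set Q := quasi_component.
have Qx0 : Q x0 by move=> eta _; exact: reach_refl.
have main B : (exists2 C, open C & B = Q `&` C) ->
    (exists2 C, closed C & B = Q `&` C) -> B x0 -> Q `\` B = set0.
  move=> [W oW BW] [C cC BC]; apply: quasi_component_split => //.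
  - by rewrite BC; apply: closedI => //; exact: quasi_component_closed.
  - have -> : Q `\` B = Q `&` ~` W.
      rewrite BW predeqE => x; split=> -[Qx].
        by move=> nB; split=> // Wx; apply: nB.
      by move=> nO; split=> // -[].
    apply: closedI; first exact: quasi_component_closed.
    exact: open_closedC.
  - rewrite setUIr setUv setIT BW predeqE => x; split; last by right.
    by move=> [[]|].
  - by rewrite setIC setDE -setIA setICl setI0.
move=> B [b Bb] [W oW BW] [C cC BC].
have BQ : B `<=` Q by rewrite BW => x [].
have [Bx0|nBx0] := pselect (B x0).
  rewrite eqEsubset; split=> // x Qx; apply: contrapT => nB.
  have : (Q `\` B) x by [].
  by rewrite main //; [exists W|exists C].
have : (Q `\` (Q `\` B)) b by split; [exact: BQ|case].
rewrite main //.
- exists (~` C); first exact: closed_openC.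
  rewrite BC predeqE => x; split=> -[Qx].
    by move=> nB; split=> // Wx; apply: nB.
  by move=> nO; split=> // -[].
- exists (~` W); first exact: open_closedC.
  rewrite BW predeqE => x; split=> -[Qx].
    by move=> nB; split=> // Wx; apply: nB.
  by move=> nO; split=> // -[].
Qed.

(** Each point of [Z] outside the open [rho]-ball is missed by some chain component, and these
    points form a compact set. *)
Lemma reach_small (rho : R) : 0 < rho -> quasi_component `<=` [set x0] ->
  exists2 eta, 0 < eta & forall x, reach Z x0 eta x -> `|x - x0| < rho.
Proof.
move=> rho0 Q1.
pose T := Z `&` [set z | forall a, [set x0] a -> rho <= `|z - a|].
have cT : compact T by apply: compact_closedI => //; exact: closed_far.
have [|x [Zx xr]|eta eta0 av] := @reach_compact_avoid _ cT.
- by move=> x [].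
- have : ~ quasi_component x.
    by move=> /Q1 xx0; have := xr x0 erefl; rewrite xx0 subrr normr0; lra.
  by move=> /existsNP[d /not_implyP[]]; exists d.
exists eta => // x rx; rewrite ltNge; apply/negP => xr; apply: (av x) => //.
by split; [exact: reach_mem rx|move=> a ->].
Qed.

End chains.

(** * Parity cocycles *)

Lemma ex_natr_gt (R : realType) (a d : R) : 0 < d -> exists N : nat, a < N.+1%:R * d.
Proof.
move=> d0; exists (Num.trunc (a / d)).
rewrite -ltr_pdivrMr //; exact: truncnS_gt.
Qed.

Lemma closed_ball_segment (R : realType) (V : normedModType R) (a x y : V)
    (r t : R) : `|x - a| <= r -> `|y - a| <= r -> 0 <= t <= 1 ->
  `|x + t *: (y - x) - a| <= r.
Proof.
move=> xr yr /andP[t0 t1].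
have -> : x + t *: (y - x) - a = (1 - t) *: (x - a) + t *: (y - a).
  have -> : y - x = (y - a) - (x - a) by rewrite opprB addrA subrK.
  by rewrite scalerBl scale1r scalerBr addrAC [RHS]addrAC addrA.
rewrite (le_trans (ler_normD _ _)) // !normrZ (ger0_norm t0) ger0_norm ?subr_ge0 //.
have -> : r = (1 - t) * r + t * r by lra.
by rewrite lerD // ler_wpM2l // subr_ge0.
Qed.

(** [s] sums [c] along the segment from [x0], cut into equal short pieces. For close [x] and [y] the
    two segments bound a ladder of small quadrilaterals; each is split into two triangles, to which
    the cocycle identity applies. *)
Lemma cocycle_primitive (R : realType) (V : normedModType R) (x0 : V)
    (r d : R) (c : V -> V -> bool) : 0 <= r -> 0 < d ->
  (forall x y z, `|x - x0| <= r -> `|y - x0| <= r -> `|z - x0| <= r ->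
     `|x - y| < d -> `|y - z| < d -> `|x - z| < d ->
     c x y (+) c y z = c x z) ->
  exists s : V -> bool, forall x y, `|x - x0| <= r -> `|y - x0| <= r ->
    `|x - y| < d / 2 -> s x (+) s y = c x y.
Proof.
move=> r0 d0 cc.
have d20 : 0 < d / 2 by rewrite divr_gt0.
have [N rN] := ex_natr_gt r d20.
pose p (k : nat) x := x0 + (k%:R / N.+1%:R) *: (x - x0).
pose s (k : nat) x := \big[addb/false]_(i < k) c (p i x) (p i.+1 x).
have N0 : 0 < N.+1%:R :> R by rewrite ltr0n.
have frac k : (k <= N.+1)%N -> 0 <= (k%:R / N.+1%:R : R) <= 1.
  by move=> kN; rewrite divr_ge0 ?ler0n //= ler_pdivrMr // mul1r ler_nat.
have pD k x : (k <= N.+1)%N -> `|x - x0| <= r -> `|p k x - x0| <= r.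
  by move=> kN xr; apply: closed_ball_segment; rewrite ?subrr ?normr0 // frac.
have pxy k x y : (k <= N.+1)%N -> `|p k x - p k y| <= `|x - y|.
  move=> kN; rewrite /p opprD addrACA subrr add0r -scalerBr opprB addrA subrK.
  by rewrite normrZ ler_piMl // ger0_norm; case/andP: (frac k kN).
have pS k x : `|x - x0| <= r -> `|p k x - p k.+1 x| < d / 2.
  move=> xr; rewrite /p opprD addrACA subrr add0r -scalerBl -mulrBl normrZ.
  rewrite -[k.+1]addn1 natrD opprD addrA subrr add0r mulN1r normrN normfV.
  rewrite (gtr0_norm N0) mulrC ltr_pdivrMr // mulrC.
  exact: le_lt_trans rN.
exists (s N.+1) => x y xr yr xy.
suff H k : (k <= N.+1)%N -> s k x (+) s k y = c (p k x) (p k y).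
  have p1 z : p N.+1 z = z by rewrite /p divff ?gt_eqF // scale1r addrC subrK.
  by rewrite H // !p1.
elim: k => [_|k IH kN].
  have p0 z : p 0%N z = x0 by rewrite /p ?mulr0n mul0r scale0r addr0.
  rewrite /s !big_ord0 !p0; have := cc x0 x0 x0.
  by rewrite !subrr !normr0 => /(_ r0 r0 r0 d0 d0 d0); case: (c x0 x0).
rewrite /s !big_ord_recr /= -!/(s k _).
have kN' := ltnW kN.
have ab := pxy _ x y kN'; have ab' := pxy _ x y kN.
have aa' := pS k x xr; have bb' := pS k y yr.
(* The diagonal is bounded by two sides shorter than [d / 2]; hence the halved radius in the
   conclusion. *)
have ab2 : `|p k x - p k.+1 y| < d.
  have := norm_triangle (p k y) (p k x) (p k.+1 y); lra.
have h1 : c (p k x) (p k y) (+) c (p k y) (p k.+1 y) = c (p k x) (p k.+1 y).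
  by apply: cc; rewrite ?pD //; lra.
have h2 : c (p k x) (p k.+1 x) (+) c (p k.+1 x) (p k.+1 y) = c (p k x) (p k.+1 y).
  by apply: cc; rewrite ?pD //; lra.
rewrite addbACA IH //; move: h1; rewrite -h2.
by do 4 case: (c _ _).
Qed.

Lemma locally_constant_convex (R : realType) (V : normedModType R)
    (D : set V) (d : R) (s : V -> bool) : 0 < d ->
  (forall x y t, D x -> D y -> 0 <= t <= 1 -> D (x + t *: (y - x))) ->
  (forall x y, D x -> D y -> `|x - y| < d -> s x = s y) ->
  forall x y, D x -> D y -> s x = s y.
Proof.
move=> d0 cD sD x y Dx Dy.
have [N rN] := ex_natr_gt `|y - x| d0.
have N0 : 0 < N.+1%:R :> R by rewrite ltr0n.
pose p (k : nat) := x + (k%:R / N.+1%:R) *: (y - x).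
have pD k : (k <= N.+1)%N -> D (p k).
  move=> kN; apply: cD => //.
  by rewrite divr_ge0 ?ler0n //= ler_pdivrMr // mul1r ler_nat.
have pS k : `|p k - p k.+1| < d.
  rewrite /p opprD addrACA subrr add0r -scalerBl -mulrBl normrZ.
  rewrite -[k.+1]addn1 natrD opprD addrA subrr add0r mulN1r normrN normfV.
  by rewrite (gtr0_norm N0) mulrC ltr_pdivrMr // mulrC.
suff H k : (k <= N.+1)%N -> s x = s (p k).
  by rewrite (H N.+1) // /p divff ?gt_eqF // scale1r addrC subrK.
elim: k => [_|k IH kN]; first by rewrite /p ?mulr0n mul0r scale0r addr0.
rewrite IH; last exact: ltnW.
by apply: sD; [apply: pD; exact: ltnW|exact: pD|exact: pS].
Qed.

Lemma norm_coord_le (R : realType) (n : nat) (v : 'cV[R]_n) (i : 'I_n) :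
  `|v i 0| <= `|v|.
Proof.
rewrite [leRHS]/Num.norm /= mx_normrE.
exact: (le_bigmax _ (fun ij => `|v ij.1 ij.2|) (i, ord0)).
Qed.

Lemma norm_le_coord (R : realType) (n : nat) (v : 'cV[R]_n) (r : R) :
  0 <= r -> (forall i, `|v i 0| <= r) -> `|v| <= r.
Proof.
move=> r0 H; rewrite [leLHS]/Num.norm /= mx_normrE.
by apply: bigmax_le => // -[i j] _ /=; rewrite ord1.
Qed.

Lemma norm_ge_coord (R : realType) (n : nat) (v : 'cV[R]_n) (r : R) :
  0 < r -> r <= `|v| -> exists i, r <= `|v i 0|.
Proof.
move=> r0; rewrite [X in _ <= X -> _]/Num.norm /= mx_normrE.
(* The first case is the default value 0 of the maximum. *)
move=> /bigmax_geP[|[[i j] _ /=]]; first by rewrite leNgt r0.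
by rewrite ord1; exists i.
Qed.

(* In the sup norm a spherical shell is a union of convex pieces, one for each
   coordinate and sign; for [n >= 2] pieces of different coordinates meet. *)
Lemma locally_constant_shell (R : realType) (n : nat) (x0 : 'cV[R]_n)
    (rho r d : R) (s : 'cV[R]_n -> bool) : (2 <= n)%N ->
  0 < rho -> rho <= r -> 0 < d ->
  (forall x y, rho <= `|x - x0| <= r -> rho <= `|y - x0| <= r ->
     `|x - y| < d -> s x = s y) ->
  exists b, forall x, rho <= `|x - x0| <= r -> s x = b.
Proof.
move=> n2 rho0 rhor d0 sD.
pose H (i : 'I_n) (b : bool) : set 'cV[R]_n :=
  [set x | `|x - x0| <= r /\ rho <= (-1) ^+ b * (x - x0) i 0].
have H_shell i b x : H i b x -> rho <= `|x - x0| <= r.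
  move=> [-> h]; rewrite andbT (le_trans h) // (le_trans (ler_norm _)) //.
  by rewrite normrMsign norm_coord_le.
have H_const i b x y : H i b x -> H i b y -> s x = s y.
  move=> Hx Hy; apply: (@locally_constant_convex _ _ (H i b) d) => //.
    move=> {Hx Hy}x {}y t [xr xi] [yr yi] t01; split.
      exact: closed_ball_segment.
    case/andP: t01 => t0 t1.
    have -> : (-1) ^+ b * (x + t *: (y - x) - x0) i 0 =
        (1 - t) * ((-1) ^+ b * (x - x0) i 0) + t * ((-1) ^+ b * (y - x0) i 0).
      by rewrite !mxE; ring.
    have -> : rho = (1 - t) * rho + t * rho by lra.
    by rewrite lerD // ler_wpM2l // subr_ge0.
  by move=> {Hx Hy}x {}y /H_shell Hx /H_shell Hy; exact: sD.
pose q (i : 'I_n) (b : bool) (j : 'I_n) (b' : bool) : 'cV[R]_n :=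
  x0 + rho *: ((-1) ^+ b *: delta_mx i 0 + (-1) ^+ b' *: delta_mx j 0).
have Hq i b j b' : i != j -> H i b (q i b j b') /\ H j b' (q i b j b').
  move=> ij.
  have qr : `|q i b j b' - x0| <= r.
    rewrite /q [x0 + _]addrC addrK normrZ gtr0_norm //.
    apply: le_trans rhor; rewrite ler_piMr ?(ltW rho0) //.
    apply: norm_le_coord => // k; rewrite !mxE !eqxx !andbT.
    have [->|ki] := eqVneq k i.
      by rewrite (negbTE ij) mulr0 addr0 mulr1 normrX normrN1 expr1n.
    rewrite mulr0 add0r; case: (k == j); rewrite ?mulr1 ?mulr0 ?normr0 //.
    by rewrite normrX normrN1 expr1n.
  split; split => //; rewrite /q [x0 + _]addrC addrK !mxE !eqxx !andbT.
    by rewrite (negbTE ij) mulr0 addr0 mulr1 mulrCA -expr2 sqrr_sign mulr1.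
  by rewrite eq_sym (negbTE ij) mulr0 add0r mulr1 mulrCA -expr2 sqrr_sign mulr1.
have H_neq i b j b' x y : i != j -> H i b x -> H j b' y -> s x = s y.
  move=> ij Hx Hy; have [h1 h2] := Hq i b j b' ij.
  by rewrite (H_const _ _ _ _ Hx h1); exact: H_const h2 Hy.
have other (i : 'I_n) : exists j, i != j.
  case: n n2 i {x0 s sD H H_shell H_const q Hq H_neq} => [|[|n]] // _ i.
  have [->|] := eqVneq i ord0; last by exists ord0.
  by exists (lift ord0 ord0).
(* Opposite faces of the same coordinate are joined through a face of another coordinate [k]. *)
have H_all i b j b' x y : H i b x -> H j b' y -> s x = s y.
  move=> Hx Hy; have [ij|] := eqVneq i j; last by move=> ij; exact: H_neq ij Hx Hy.
  have [k ik] := other i; have [h1 h2] := Hq i b k true ik.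
  rewrite (H_neq _ _ _ _ _ _ ik Hx h2); apply/esym.
  by apply: H_neq _ Hy h2; rewrite -ij.
have H_ex x : rho <= `|x - x0| <= r -> exists i b, H i b x.
  move=> /andP[/(norm_ge_coord rho0)[i xi] xr].
  exists i, ((x - x0) i 0 < 0); split => //.
  by rewrite -normrEsign.
pose i0 : 'I_n := Ordinal (ltnW n2).
have [j0 ij0] := other i0; have [h _] := Hq i0 true j0 true ij0.
exists (s (q i0 true j0 true)) => x /H_ex[i [b Hx]].
exact: H_all Hx h.
Qed.

(** In the application [u] is the indicator of [U] and [g] that of [F < F x0]. The primitive [s] of
    [c] jumps only where [u] does with [g] true, and [s (+) u] only where [u] does with [g] false;
    [b] records which of the two yields [w]. *)
Lemma separation_one_side (R : realType) (n : nat) (x0 : 'cV[R]_n)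
    (rho r d : R) (u g : 'cV[R]_n -> bool) : (2 <= n)%N ->
  0 < rho -> rho <= r -> 0 < d ->
  (forall x y, `|x - x0| <= r -> `|y - x0| <= r -> `|x - y| < d ->
     u x != u y -> g x = g y) ->
  u x0 -> (forall x, rho <= `|x - x0| <= r -> ~~ u x) ->
  exists w : 'cV[R]_n -> bool, exists b : bool,
  [/\ w x0, (forall x, rho <= `|x - x0| <= r -> ~~ w x) &
    forall x y, `|x - x0| <= r -> `|y - x0| <= r -> `|x - y| < d / 2 ->
      w x != w y -> u x != u y /\ g x = b].
Proof.
move=> n2 rho0 rhor d0 ug ux0 ushell.
pose c x y := (u x (+) u y) && g x.
have [||s sc] := @cocycle_primitive _ _ x0 r d c _ d0.
- by rewrite (le_trans _ rhor) ?ltW.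
- move=> x y z xr yr zr xy yz xz.
  move: (ug x y xr yr xy) (ug y z yr zr yz) (ug x z xr zr xz); rewrite /c.
  by case: (u x); case: (u y); case: (u z); case: (g x); case: (g y);
    case: (g z) => //= h1 h2 h3; first [by move: (h1 isT)|by move: (h2 isT)|by move: (h3 isT)].
have d20 : 0 < d / 2 by rewrite divr_gt0.
have [|sigma ssig] := @locally_constant_shell _ _ x0 rho r (d / 2) s n2 rho0 rhor d20.
  move=> x y xs ys xy; case/andP: (xs) => _ xr; case/andP: (ys) => _ yr.
  have := sc x y xr yr xy; rewrite /c (negbTE (ushell _ xs)) (negbTE (ushell _ ys)).
  by case: (s x); case: (s y).
(* On the shell both [s] and [s (+) u] equal [sigma]. If [s x0] differs from it, [s] separates [x0]
   from the shell; otherwise [s (+) u] does, because [u x0] holds. *)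
have [sx0|sx0] := eqVneq (s x0) sigma; last first.
  exists (fun x => s x != sigma), true; split => //.
    by move=> x /ssig ->; rewrite eqxx.
  move=> x y xr yr /(sc x y xr yr); rewrite /c.
  by case: (s x); case: (s y); case: sigma {ssig sx0}; case: (u x); case: (u y); case: (g x).
exists (fun x => s x (+) u x != sigma), false; split => //.
- by rewrite sx0 ux0; case: sigma {ssig sx0}.
- by move=> x xs; rewrite ssig // (negbTE (ushell _ xs)) addbF eqxx.
move=> x y xr yr /(sc x y xr yr); rewrite /c.
by case: (s x); case: (s y); case: sigma {ssig sx0}; case: (u x); case: (u y); case: (g x).
Qed.

(** * Separating an isolated point of a level set *)

Lemma compact_level (R : realType) (n : nat) (x0 : 'cV[R]_n) (r c : R)
    (F : 'cV[R]_n -> R) :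
  (forall x, `|x - x0| <= r -> {for x, continuous F}) ->
  compact [set x | `|x - x0| <= r /\ F x = c].
Proof.
move=> cF.
apply: (subclosed_compact _ (@compact_closed_ball R n x0 r)); last by move=> x [].
move=> x xcl.
have xr : `|x - x0| <= r.
  have : closed [set x | `|x - x0| <= r].
    apply: compact_closed; first exact: norm_hausdorff.
    exact: compact_closed_ball.
  by apply => B /xcl[y [[yr _] By]]; exists y.
split=> //; apply/eqP; rewrite -subr_eq0 -normr_eq0; apply/negPn/negP => ne.
have e0 : 0 < `|F x - c| by rewrite lt_neqAle eq_sym ne normr_ge0.
have /cvgrPdist_lt/(_ _ e0)/xcl[y [[_ Fy]]] := cF x xr.
by rewrite /= Fy ltxx.
Qed.

(** Let [u] be the [eta / 3]-neighbourhood of a small [eta]-chain component. A short pair crossing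
    its boundary has its outer point at distance at least [eta / 3] from all of [Z], and on such
    points compactness bounds [F - F x0] away from 0. *)
Lemma isolated_separation (R : realType) (n : nat) (x0 : 'cV[R]_n) (rho r : R)
    (F : 'cV[R]_n -> R) : (2 <= n)%N -> 0 < rho -> rho <= r ->
  (forall x, `|x - x0| <= r -> {for x, continuous F}) ->
  quasi_component [set x | `|x - x0| <= r /\ F x = F x0] x0 `<=` [set x0] ->
  exists w : 'cV[R]_n -> bool, exists b : bool, exists d m : R,
  [/\ 0 < d, 0 < m, w x0, forall x, rho <= `|x - x0| <= r -> ~~ w x &
    forall x y, `|x - x0| <= r -> `|y - x0| <= r -> `|x - y| < d ->
      w x != w y -> m <= (-1) ^+ b * (F x - F x0)].
Proof.
move=> n2 rho0 rhor cF Q1; set Z := [set x | _] in Q1.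
have cZ : compact Z by exact: compact_level.
have Zx0 : Z x0 by rewrite /Z /= subrr normr0 (le_trans _ rhor) ?ltW.
have rho20 : 0 < rho / 2 by rewrite divr_gt0.
have [eta1 eta10 eta1P] := reach_small cZ Zx0 rho20 Q1.
pose eta := Num.min eta1 rho.
have eta0 : 0 < eta by rewrite lt_min eta10.
have etarho : eta <= rho by rewrite ge_min lexx orbT.
have etaP x : reach Z x0 eta x -> `|x - x0| < rho / 2.
  by move=> H; apply: eta1P; apply: reach_le H; rewrite ge_min lexx.
pose u x := `[< exists2 z, reach Z x0 eta z & `|x - z| < eta / 3 >].
pose S := [set x | `|x - x0| <= r] `&` [set x | forall z, Z z -> eta / 3 <= `|x - z|].
have cS : compact S.
  by apply: compact_closedI; [exact: compact_closed_ball|exact: closed_far].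
have [||m0 m00 m0P] := @compact_lower_bound R _ S (fun x => `|F x - F x0|) cS.
- move=> x [xr _]; apply: (@cvg_norm _ _ _ (nbhs x) _ (fun y => F y - F x0)).
  by apply: (@cvgB _ _ _ (nbhs x) _ F (fun=> F x0)); [exact: cF|exact: cvg_cst].
- move=> x [xr xZ]; rewrite normr_gt0; apply/negP; rewrite subr_eq0 => /eqP Fx.
  by have := xZ x (conj xr Fx); rewrite subrr normr0; lra.
(* The other half of [m0] is left for the oscillation of [F] along a pair, so that both ends have
   the same sign and size at least [m]. *)
pose m := m0 / 2.
have m_gt0 : 0 < m by rewrite divr_gt0.
have [d1 d10 d1P] := @compact_uniform_continuity R _ _ _ F m
  (@compact_closed_ball R n x0 r) cF m_gt0.
pose d := Num.min d1 (eta / 3).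
have d0 : 0 < d by rewrite lt_min d10 divr_gt0.
have cross0 x y : `|x - x0| <= r -> `|y - x0| <= r -> `|x - y| < d ->
    u x -> ~~ u y -> m0 <= `|F y - F x0|.
  move=> xr yr; rewrite lt_min => /andP[_ xy] /asboolP[z rz xz] /asboolPn ny.
  rewrite leNgt; apply/negP => Fy.
  (* A point [z'] of [Z] closer than [eta / 3] to [y] is less than [eta] away from [z]; one more
     jump would reach it and put [y] in [u]. *)
  have /existsNP[z' /not_implyP[Zz' /negP]] :
      ~ (forall z, Z z -> eta / 3 <= `|y - z|).
    by move=> H; have := m0P y (conj yr H); rewrite leNgt Fy.
  rewrite -ltNge => yz'; apply: ny; exists z' => //.
  apply: (reach_step rz Zz').
  have := norm_triangle x z z'; have := norm_triangle y x z'.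
  by rewrite (distrC z x); lra.
have cross x y : `|x - x0| <= r -> `|y - x0| <= r -> `|x - y| < d ->
    u x != u y -> (m <= F x - F x0 /\ m <= F y - F x0) \/
                  (F x - F x0 <= - m /\ F y - F x0 <= - m).
  move=> xr yr xy uxy.
  have Fxy : `|F x - F y| < m.
    by apply: d1P => //; apply: lt_le_trans xy _; rewrite ge_min lexx.
  have : m0 <= `|F y - F x0| \/ m0 <= `|F x - F x0|.
    move: uxy; case ux : (u x); case uy : (u y) => // _.
      by left; apply: (cross0 x y) => //; rewrite ?ux ?uy.
    by right; apply: (cross0 y x) => //; rewrite ?ux ?uy // distrC.
  move: Fxy; rewrite ltr_norml => /andP[? ?].
  have mE : m0 = m + m by rewrite /m; lra.
  by rewrite !ler_normr => -[|] /orP[] ?; [left|right|left|right]; split; lra.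
have [|||w [b [wx0 wsh wP]]] :=
    @separation_one_side R n x0 rho r d u (fun x => F x < F x0) n2 rho0 rhor d0.
- move=> x y xr yr xy /(cross _ _ xr yr xy)[|] [? ?].
    by rewrite !ltNge; congr (~~ _); apply/idP/idP => _; lra.
  by apply/idP/idP => _; lra.
- by apply/asboolP; exists x0; [exact: reach_refl|rewrite subrr normr0 divr_gt0].
- move=> x /andP[xrho _]; apply/asboolPn => -[z /etaP zr xz].
  by have := norm_triangle z x x0; lra.
exists w, b, (d / 2), m; split => //; first by rewrite divr_gt0.
move=> x y xr yr xy wxy; have [uxy <-] := wP x y xr yr xy wxy.
have xyd : `|x - y| < d by lra.
have [[? ?]|[? ?]] := cross x y xr yr xyd uxy.
  by rewrite ltNge (_ : F x0 <= F x) /= ?expr0 ?mul1r //; lra.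
by rewrite (_ : F x < F x0) /= ?expr1 ?mulN1r //; lra.
Qed.

(** * Existence of solutions *)

Lemma ultra_fmap (T U : Type) (f : T -> U) (F : set_system T) :
  UltraFilter F -> UltraFilter (f @ F).
Proof.
move=> FU; split; first exact: fmap_proper_filter.
move=> G GP FG; rewrite eqEsubset; split=> // A GA.
have [//|FnA] := in_ultra_setVsetC (f @^-1` A) FU.
have GnA : G (~` A) by exact: FG.
have [x []] := @filter_ex _ G _ _ (filterI GA GnA).
by [].
Qed.

Section euler.
Context (R : realType) (n : nat) (f : 'cV[R]_n -> 'cV[R]_n) (p : 'cV[R]_n).

Definition euler (h : R) (k : nat) : 'cV[R]_n := iter k (fun y => y + h *: f y) p.

Definition euler_time (N : nat) (t : R) : nat := Num.trunc (t * N.+1%:R).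

(** With step [1 / (N + 1)], a step function in [t]: the value at the last grid time up to [t],
    without interpolation. *)
Definition euler_path (N : nat) (t : R) : 'cV[R]_n :=
  euler N.+1%:R^-1 (euler_time N t).

Lemma euler_dist (h M : R) : 0 <= h -> (forall x, `|f x| <= M) ->
  forall i j, (i <= j)%N -> `|euler h j - euler h i| <= h * (j - i)%:R * M.
Proof.
move=> h0 fM i j ij; rewrite -(subnKC ij) addKn.
elim: (j - i)%N => [|k IH]; first by rewrite addn0 subrr normr0 mulr0 mul0r.
rewrite addnS; set a := euler h (i + k).
have -> : euler h (i + k).+1 = a + h *: f a by [].
rewrite addrAC (le_trans (ler_normD _ _)) // normrZ ger0_norm //.
rewrite -[k.+1]addn1 natrD mulrDr mulr1 mulrDl lerD //.
by rewrite ler_wpM2l.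
Qed.

(** By the speed bound [M] the iterates stay within [d] of the [i]-th one, so each increment differs
    from [h *: f (euler h i)] by at most [h * e]. *)
Lemma euler_taylor (h M d e : R) : 0 <= h -> (forall x, `|f x| <= M) ->
  (forall x y, `|x - y| < d -> `|f x - f y| <= e) ->
  forall i j, (i <= j)%N -> h * (j - i)%:R * M < d ->
  `|euler h j - euler h i - (h * (j - i)%:R) *: f (euler h i)|
    <= h * (j - i)%:R * e.
Proof.
move=> h0 fM fd i j ij; rewrite -(subnKC ij) addKn.
have M0 : 0 <= M by exact: le_trans (fM 0).
elim: (j - i)%N => [_|k IH].
  by rewrite addn0 subrr mulr0 scale0r subr0 normr0 mul0r.
rewrite -[k.+1]addn1 natrD mulrDr mulr1 => kd.
have hkd : h * k%:R * M < d.
  by apply: le_lt_trans kd; rewrite ler_wpM2r // lerDl.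
have {}IH := IH hkd.
rewrite addn1 addnS; set a := euler h (i + k) in IH *.
have -> : euler h (i + k).+1 = a + h *: f a by [].
have -> : a + h *: f a - euler h i - (h * k%:R + h) *: f (euler h i) =
    (a - euler h i - (h * k%:R) *: f (euler h i)) + h *: (f a - f (euler h i)).
  by apply/matrixP => k1 k2; rewrite !mxE; ring.
rewrite (le_trans (ler_normD _ _)) // mulrDl lerD // normrZ ger0_norm //.
rewrite ler_wpM2l // fd //; apply: le_lt_trans hkd.
have := euler_dist h0 fM (leq_addr k i); rewrite addKn; exact.
Qed.

Lemma euler_time_itv (N : nat) (t : R) : 0 <= t ->
  t - N.+1%:R^-1 < N.+1%:R^-1 * (euler_time N t)%:R <= t.
Proof.
move=> t0; have N0 : 0 < N.+1%:R :> R by rewrite ltr0n.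
have /andP[h1 h2] : ((euler_time N t)%:R : R) <= t * N.+1%:R < (euler_time N t).+1%:R.
  by apply: truncn_itv; rewrite mulr_ge0 // ltW.
rewrite mulrC ler_pdivrMr // h1 andbT ltr_pdivlMr // mulrBl mulVf ?gt_eqF //.
by move: h2; rewrite -natr1; lra.
Qed.

Lemma euler_time_cvg (t : R) : 0 <= t ->
  (N.+1%:R^-1 * (euler_time N t)%:R : R) @[N --> \oo] --> t.
Proof.
move=> t0; apply/cvgrPdist_lt => e e0; near=> N.
have /andP[h1 h2] := euler_time_itv N t0.
rewrite ger0_norm ?subr_ge0 //.
have : N.+1%:R^-1 < e by near: N; exact: (near_infty_natSinv_lt (PosNum e0)).
by apply: lt_trans; rewrite ltrBlDr -ltrBlDl.
Unshelve. all: by end_near. Qed.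

Lemma euler_time_le (N : nat) (s t : R) : s <= t ->
  (euler_time N s <= euler_time N t)%N.
Proof. by move=> st; apply: le_truncn; rewrite ler_wpM2r. Qed.

(* Ultrafilter limits of the Euler polygons exist pointwise by compactness of
   balls, and the estimates uniform in the step size pass to the limit. *)
Lemma bounded_ode_exists (M : R) : (forall x, `|f x| <= M) ->
  (forall e, 0 < e -> exists2 d, 0 < d &
    forall x y, `|x - y| < d -> `|f x - f y| <= e) ->
  exists2 x : R -> 'cV[R]_n, x 0 = p &
    forall e, 0 < e -> exists2 d, 0 < d & forall s t, 0 <= s -> s <= t ->
      t - s < d -> `|x t - x s - (t - s) *: f (x s)| <= (t - s) * e.
Proof.
move=> fM fu.
have M0 : 0 <= M by exact: le_trans (fM 0).
have [U [UU sU]] := @ultraFilterLemma nat \oo _.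
have bnd N t : 0 <= t -> `|euler_path N t - p| <= t * M.
  move=> t0; have := @euler_dist N.+1%:R^-1 M _ fM 0 (euler_time N t) isT.
  rewrite invr_ge0 ler0n subn0 => /(_ isT) /le_trans; apply.
  by rewrite ler_wpM2r //; case/andP: (euler_time_itv N t0).
(* The guard [0 <= t] sits inside the existential so that a limit can be chosen for every real [t];
   negative times get the dummy value [p]. *)
have xE (t : R) : exists l : 'cV[R]_n, 0 <= t -> (euler_path ^~ t) @ U --> l.
  have [t0|_] := boolP (0 <= t); last by exists p.
  have := @compact_closed_ball R n p (t * M); rewrite compact_ultra.
  move=> /(_ (euler_path ^~ t @ U)) [].
  - exact: ultra_fmap.
  - by apply: (@filterS _ U _ setT); [move=> N _; exact: bnd|exact: filterT].
  - by move=> l [_ ?]; exists l.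
have [x xP] := choice xE.
exists x.
  apply: (@cvg_unique _ (@norm_hausdorff _ _) (euler_path ^~ 0 @ U)).
    by apply: xP.
  rewrite (_ : euler_path ^~ 0 = fun=> p); first exact: cvg_cst.
  by apply/funext => N; rewrite /euler_path /euler_time mul0r truncn0.
move=> e e0; have [d d0 dP] := fu e e0.
have M10 : 0 < M + 1 by lra.
exists (d / (M + 1)); first by rewrite divr_gt0.
move=> s t s0 st; rewrite ltr_pdivlMr // => tsd.
have t0 : 0 <= t by exact: le_trans st.
pose tau (N : nat) : R := N.+1%:R^-1 * (euler_time N t - euler_time N s)%:R.
have tau_cvg : tau N @[N --> U] --> t - s.
  apply: (@cvg_trans _ (tau N @[N --> \oo])); first by move=> A; exact: sU.
  rewrite (_ : tau = fun N => N.+1%:R^-1 * (euler_time N t)%:R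
                           - N.+1%:R^-1 * (euler_time N s)%:R).
    by apply: cvgB; exact: euler_time_cvg.
  by apply/funext => N; rewrite /tau natrB ?euler_time_le // mulrBr.
have fx : f (euler_path N s) @[N --> U] --> f (x s).
  apply: (@cvg_comp _ _ _ (euler_path ^~ s) f U (nbhs (x s))); first exact: xP.
  apply/cvgrPdist_le => k k0; have [r r0 rP] := fu k k0.
  by apply/nbhs_ballP; exists r => //= y; rewrite -ball_normE => /rP.
(* The estimate of [euler_taylor] passes to the limit along [U]; the elapsed grid time [tau N] tends
   to [t - s]. *)
apply: (@ler_cvg_to nat U _ _
  (fun N => `|euler_path N t - euler_path N s - tau N *: f (euler_path N s)|)
  (fun N => tau N * e)).
- apply: cvg_norm; apply: cvgB; last exact: cvgZ.
  by apply: cvgB; apply: xP.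
- by apply: cvgM => //; exact: cvg_cst.
have tsM : (t - s) * M < d.
  apply: le_lt_trans tsd; rewrite ler_wpM2l ?subr_ge0 //; lra.
near=> N.
apply: (@euler_taylor _ M d) => //; first exact: euler_time_le.
rewrite -/(tau N).
near: N.
have tauM : tau N * M @[N --> U] --> (t - s) * M.
  by apply: cvgM => //; exact: cvg_cst.
by apply: (cvgr_lt _ tauM); exact: tsM.
Unshelve. all: by end_near. Qed.

End euler.

(** * First-order estimates *)

Lemma is_derive_line (R : realType) (V : normedModType R) (F : V -> R)
    (z v : V) (t : R) : derivable F (z + t *: v) v ->
  is_derive t 1 (fun u => F (z + u *: v)) ('D_v F (z + t *: v)).
Proof.
move=> dF.
have E : (fun h : R => h^-1 *: (F (h *: v + (z + t *: v)) - F (z + t *: v))) =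
    (fun h => h^-1 *: (((fun u => F (z + u *: v)) \o shift t) (h *: 1) -
                       F (z + t *: v))).
  apply/funext => h /=; congr (_ *: (F _ - _)).
  by rewrite [h *: 1]mulr1 scalerDl addrCA.
apply: DeriveDef; first by rewrite /derivable -E.
by rewrite /derive -E.
Qed.

Lemma directional_increment (R : realType) (V : normedModType R) (F : V -> R)
    (z v : V) (a c e : R) :
  (forall t : R, `|t| <= `|a| -> derivable F (z + t *: v) v /\
     `|'D_v F (z + t *: v) - c| <= e) ->
  `|F (z + a *: v) - F z - c * a| <= e * `|a|.
Proof.
move=> H; pose phi u := F (z + u *: v).
have dphi (t : R) : `|t| <= `|a| -> is_derive t 1 phi ('D_v F (z + t *: v)).
  by move=> /H[dF _]; exact: is_derive_line.
have mvt (l u : R) : l <= u -> (forall t, l <= t <= u -> `|t| <= `|a|) ->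
    exists2 t, `|t| <= `|a| & phi u - phi l = 'D_v F (z + t *: v) * (u - l).
  move=> lu lua.
  have [||t] := @MVT_segment R phi (fun t => 'D_v F (z + t *: v)) l u lu.
  - by move=> t; rewrite in_itv /= => /andP[? ?]; apply/dphi/lua; rewrite !ltW.
  - apply: derivable_within_continuous => t; rewrite in_itv /= => /lua/dphi D.
    exact: @ex_derive D.
  by rewrite in_itv /= => /lua; exists t.
have phi0 : phi 0 = F z by rewrite /phi scale0r addr0.
suff [t /H[_ Dt]] : exists2 t, `|t| <= `|a| &
    phi a - phi 0 = 'D_v F (z + t *: v) * a.
  by rewrite phi0 /phi => ->; rewrite -mulrBl normrM ler_wpM2r.
have [a0|a0] := leP 0 a.
  have [|t ta E] := mvt 0 a a0; last by exists t => //; rewrite E subr0.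
  by move=> t /andP[t0 ta]; rewrite !ger0_norm.
have [|t ta E] := mvt a 0 (ltW a0).
  by move=> t /andP[ta t0]; rewrite !ler0_norm ?(ltW a0) // lerN2.
by exists t => //; rewrite -opprB E sub0r mulrN opprK.
Qed.

(* Moves from [x] to [y] one coordinate at a time. *)
Lemma C1_first_order (R : realType) (n : nat) (G : set 'cV[R]_n)
    (F : 'cV[R]_n -> R) (x : 'cV[R]_n) (e : R) :
  open G -> Ck G 1 F -> G x -> 0 < e ->
  exists2 d, 0 < d & forall y, `|y - x| < d ->
    `|F y - F x - \sum_i grad F x i 0 * (y - x) i 0| <= e * `|y - x|.
Proof.
move=> oG [_ dF] Gx e0.
have n0 : 0 < n.+1%:R :> R by rewrite ltr0n.
(* Dividing by [n.+1] also covers [n = 0]; the [n] coordinate errors still add up to at most [e]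
   times the norm of [y - x]. *)
have en0 : 0 < e / n.+1%:R by rewrite divr_gt0.
have : \forall y \near x, G y /\ forall i, `|partial i F y - partial i F x| < e / n.+1%:R.
  near=> y; split; first by near: y; exact: open_nbhs_nbhs.
  near: y; apply: filter_forall => i.
  have [_ [cp _]] := dF i.
  by have /cvgrPdist_lt/(_ _ en0) := cp x Gx; apply: filterS => y; rewrite distrC.
move=> /nbhs_ballP[d /= d0 dP]; exists d => // y yx.
pose z (k : nat) : 'cV[R]_n := \col_i (if (i < k)%N then y i 0 else x i 0).
have z0 : z 0%N = x by apply/colP => i; rewrite mxE ltn0.
have zn : z n = y by apply/colP => i; rewrite mxE ltn_ord.
have zS (i : 'I_n) : z i.+1 = z i + (y - x) i 0 *: delta_mx i 0.
  apply/colP => j; rewrite !mxE eqxx andbT ltnS leq_eqVlt.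
  have [->|ij] := eqVneq j i; first by rewrite eqxx ltnn /= mulr1 addrC subrK.
  by rewrite (negbTE (_ : val j != val i)) //= mulr0 addr0.
have step (i : 'I_n) :
    `|F (z i.+1) - F (z i) - grad F x i 0 * (y - x) i 0| <= e / n.+1%:R * `|y - x|.
  rewrite zS; apply: le_trans (_ : _ <= e / n.+1%:R * `|(y - x) i 0|) _; last first.
    by rewrite ler_wpM2l ?(ltW en0) // norm_coord_le.
  apply: directional_increment => t ta.
  have [] : G (z i + t *: delta_mx i 0) /\ forall j,
      `|partial j F (z i + t *: delta_mx i 0) - partial j F x| < e / n.+1%:R.
    apply: dP; rewrite -ball_normE /= distrC; apply: le_lt_trans yx.
    apply: norm_le_coord => // j; rewrite !mxE eqxx andbT.
    have [->|ji] := eqVneq j i.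
      by rewrite ltnn mulr1 addrAC subrr add0r (le_trans ta) // norm_coord_le.
    rewrite mulr0 addr0; case: ifP => _; last by rewrite subrr normr0.
    by have := norm_coord_le (y - x) j; rewrite !mxE.
  move=> Gz /(_ i) /ltW; rewrite mxE; split => //.
  by have [+ _] := dF i; apply.
have -> : F y - F x = \sum_(i < n) (F (z i.+1) - F (z i)).
  rewrite -(big_mkord predT (fun i => F (z i.+1) - F (z i))).
  by rewrite telescope_sumr // zn z0.
rewrite -sumrB (le_trans (ler_norm_sum _ _ _)) //.
apply: le_trans (_ : _ <= \sum_(i < n) e / n.+1%:R * `|y - x|) _.
  by apply: ler_sum => i _; exact: step.
rewrite sumr_const card_ord -[_ *+ n]mulr_natr mulrAC ler_wpM2r //.
by rewrite -mulrA ler_piMr ?(ltW e0) // ler_pdivrMl // mulr1 ler_nat.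
Unshelve. all: by end_near. Qed.

(** Take the supremum [t] of the times up to [T] through which [P] holds without failure. Closure
    from the left gives [P t], and the step to the right would pass [t] unless [t = T]. *)
Lemma real_induction (R : realType) (P : R -> Prop) :
  P 0 ->
  (forall t, 0 <= t -> P t -> exists2 d, 0 < d & forall s, t <= s < t + d -> P s) ->
  (forall t, 0 < t -> (forall s, 0 <= s < t -> P s) -> P t) ->
  forall t, 0 <= t -> P t.
Proof.
move=> P0 Pright Pleft T T0.
pose S := [set t | 0 <= t <= T /\ forall s, 0 <= s <= t -> P s].
have S0 : S 0.
  split; first by rewrite lexx.
  by move=> s /andP[? ?]; have -> : s = 0 by apply/eqP; rewrite eq_le; apply/andP.
have hS : has_sup S.
  by split; [exists 0|exists T => t [/andP[]]].
pose t := sup S.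
have tT : t <= T by apply: ge_sup; [exists 0|move=> u [/andP[]]].
have t0 : 0 <= t by apply: ub_le_sup => //; case: hS.
have Pt s : 0 <= s < t -> P s.
  move=> /andP[s0 st]; have ts0 : 0 < t - s by rewrite subr_gt0.
  have [u [_ Pu] su] := sup_adherent ts0 hS.
  by apply: Pu; rewrite s0 /=; move: su; rewrite -/t; lra.
have Ptt : P t.
  have [->//|tn0] := eqVneq t 0.
  by apply: Pleft => //; rewrite lt_neqAle eq_sym tn0.
have [d d0 dP] := Pright t t0 Ptt.
have [TE|tT'] := eqVneq t T; first by rewrite -TE.
exfalso.
pose u := Num.min T (t + d / 2).
have tu : t < u by rewrite /u lt_min lt_neqAle tT' tT /= ltrDl divr_gt0.
have : S u.
  split; first by rewrite (le_trans t0 (ltW tu)) /u ge_min lexx.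
  move=> s /andP[s0 su]; have [ts|st] := leP t s; last by apply: Pt; rewrite s0.
  by apply: dP; move: su; rewrite ts /u le_min => /andP[_]; lra.
move=> /(ub_le_sup (proj2 hS)); rewrite -/t; lra.
Qed.

(** * Invariant regions *)

(** The derivative condition of [solution] with the quotient cleared, close to the form in which the
    Euler estimate arrives. *)
Definition tangent (R : realType) (n : nat) (x : R -> 'cV[R]_n) (t : R)
    (v : 'cV[R]_n) : Prop :=
  forall k, 0 < k -> exists2 d, 0 < d & forall s, 0 <= s -> `|s - t| < d ->
    `|x s - x t - (s - t) *: v| <= `|s - t| * k.

Lemma tangentP (R : realType) (n : nat) (x : R -> 'cV[R]_n) (t : R)
    (v : 'cV[R]_n) :
  ((s - t)^-1 *: (x s - x t) @[s --> within [set s : R | 0 <= s] t^'] --> v) <->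
  tangent x t v.
Proof.
have quot s : s != t -> x s - x t - (s - t) *: v =
    (s - t) *: ((s - t)^-1 *: (x s - x t) - v).
  by move=> st; rewrite scalerBr scalerA divff ?subr_eq0 // scale1r.
split=> [/cvgrPdist_lt H k k0|H].
  have /nbhs_ballP[d /= d0 dP] := H k k0; exists d => // s s0 st.
  have [->|nst] := eqVneq s t; first by rewrite !subrr scale0r subrr !normr0 mul0r.
  rewrite quot // normrZ ler_wpM2l // distrC ltW //.
  by apply: dP => //; rewrite -ball_normE /= distrC.
apply/cvgrPdist_lt => e e0; have e20 : 0 < e / 2 by rewrite divr_gt0.
have [d d0 dP] := H _ e20; apply/nbhs_ballP; exists d => //= s.
rewrite -ball_normE /= distrC => st nst s0; have := dP s s0 st.
rewrite quot // normrZ ler_pM2l ?normr_gt0 ?subr_eq0 // distrC => /le_lt_trans.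
by apply; lra.
Qed.

Lemma tangent_continuous (R : realType) (n : nat) (x : R -> 'cV[R]_n) (t e : R)
    (v : 'cV[R]_n) : tangent x t v -> 0 < e ->
  exists2 d, 0 < d & forall s, 0 <= s -> `|s - t| < d -> `|x s - x t| < e.
Proof.
move=> /(_ 1 ltr01)[d d0 dP] e0.
have v0 : 0 < `|v| + 1 by rewrite ltr_wpDl.
exists (Num.min d (e / (`|v| + 1))); first by rewrite lt_min d0 divr_gt0.
move=> s s0; rewrite lt_min ltr_pdivlMr // => /andP[/(dP s s0) h].
apply: le_lt_trans.
rewrite -[x s - x t](subrK ((s - t) *: v)) (le_trans (ler_normD _ _)) //.
by rewrite mulrDr addrC lerD // normrZ.
Qed.

(** To first order [x s - x t] is [- (s - t) *: g], so [F] changes by [- (s - t)] times the sum of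
    the squares of the entries of [g], which is at most 0; the slope [e] absorbs the errors. *)
Lemma gradient_descent (R : realType) (n : nat) (G : set 'cV[R]_n)
    (F : 'cV[R]_n -> R) (x : R -> 'cV[R]_n) (t e : R) :
  open G -> Ck G 1 F -> G (x t) -> 0 <= t ->
  tangent x t (gradient_system F (x t)) -> 0 < e ->
  exists2 d, 0 < d & forall s, t <= s < t + d ->
    F (x s) <= F (x t) + e * (s - t).
Proof.
move=> oG hF Gx t0 xt e0; set g := grad F (x t).
have gE : gradient_system F (x t) = - g by [].
pose A := \sum_i `|g i 0|.
have A0 : 0 < A + 1 by rewrite ltr_wpDl // sumr_ge0.
pose K := `|g| + 1.
have K0 : 0 < K by rewrite ltr_wpDl.
(* Half of [e] pays for the deviation of [x] from its tangent, weighted by [A]; the other half for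
   the remainder of [F], since the increment of [x] is at most [(s - t) * K]. *)
pose k := Num.min 1 (e / 2 / (A + 1)).
have k0 : 0 < k by rewrite lt_min ltr01 !divr_gt0.
have k1 : k <= 1 by rewrite ge_min lexx.
have kA : A * k <= e / 2.
  have : k * (A + 1) <= e / 2 by rewrite -ler_pdivlMr // ge_min lexx orbT.
  by lra.
have eK0 : 0 < e / 2 / K by rewrite !divr_gt0.
have [d1 d10 d1P] := C1_first_order oG hF Gx eK0.
have [d2 d20 d2P] := xt k k0.
exists (Num.min d2 (d1 / K)); first by rewrite lt_min d20 divr_gt0.
move=> s /andP[ts]; rewrite -ltrBlDl lt_min ltr_pdivlMr // => /andP[sd2 sd1].
have s0 : 0 <= s by exact: le_trans ts.
have u0 : 0 <= s - t by rewrite subr_ge0.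
set u := s - t in u0 sd1 sd2 *.
have := d2P s s0; rewrite -/u ger0_norm // => /(_ sd2).
set D := x s - x t; rewrite gE scalerN opprK; set q := D + u *: g => qk.
have DE : D = q - u *: g by rewrite addrK.
have Du : `|D| <= u * K.
  rewrite DE (le_trans (ler_normB _ _)) // normrZ ger0_norm // mulrDr mulr1 addrC.
  by rewrite lerD // (le_trans qk) // -[leRHS]mulr1 ler_wpM2l.
have := d1P (x s) (le_lt_trans Du sd1); rewrite -/D -/g.
have sumE : \sum_i g i 0 * D i 0 <= u * (e / 2).
  have -> : \sum_i g i 0 * D i 0 = \sum_i g i 0 * q i 0 - u * \sum_i g i 0 ^+ 2.
    rewrite mulr_sumr -sumrB; apply: eq_bigr => i _.
    by rewrite DE !mxE; ring.
  have : 0 <= u * \sum_i g i 0 ^+ 2.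
    by rewrite mulr_ge0 // sumr_ge0 // => i _; exact: sqr_ge0.
  have : \sum_i g i 0 * q i 0 <= A * (u * k).
    rewrite mulr_suml; apply: ler_sum => i _.
    rewrite (le_trans (ler_norm _)) // normrM ler_wpM2l //.
    exact: le_trans (norm_coord_le q i) qk.
  have : A * (u * k) <= u * (e / 2) by rewrite mulrCA ler_wpM2l.
  by lra.
have : e / 2 / K * `|D| <= u * (e / 2).
  rewrite (le_trans (ler_wpM2l (ltW eK0) Du)) // mulrCA divfK ?gt_eqF //.
by rewrite ler_norml => h1 /andP[_ h2]; lra.
Qed.

Section invariance.
Context (R : realType) (n : nat) (x0 : 'cV[R]_n) (rho r d m : R).
Context (F : 'cV[R]_n -> R) (w : 'cV[R]_n -> bool).
Hypotheses (rho_r : rho < r) (d0 : 0 < d).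
Hypothesis cF : forall y, `|y - x0| <= r -> {for y, continuous F}.
Hypothesis w_shell : forall y, rho <= `|y - x0| <= r -> ~~ w y.
Hypothesis w_cross : forall y z, `|y - x0| <= r -> `|z - x0| <= r ->
  `|y - z| < d -> w y != w z -> m <= F y - F x0.

(** A short move out of [w] would be a crossing, which requires [F y] to be at least [F x0 + m]. The
    bound [r - rho] keeps [z] in the [r]-ball, and there [w] excludes the shell. *)
Lemma low_neighbor y z : `|y - x0| < rho -> w y -> F y - F x0 < m ->
  `|y - z| < Num.min d (r - rho) -> `|z - x0| < rho /\ w z.
Proof.
move=> yrho wy Fy; rewrite lt_min => /andP[yzd yz].
have zr : `|z - x0| <= r.
  by have := norm_triangle y z x0; rewrite (distrC z y); lra.
have wz : w z.
  apply/negPn/negP => nwz; suff : m <= F y - F x0 by rewrite leNgt Fy.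
  by apply: (@w_cross y z) => //; [exact: ltW (lt_trans yrho rho_r)|rewrite wy (negbTE nwz)].
split => //; rewrite ltNge; apply/negP => zrho.
by have := w_shell (y := z); rewrite zrho zr wz => /(_ isT).
Qed.

(** Continuous induction carries membership in [w] together with an upper bound on [F] that forbids
    crossings. Descent is asked only inside the ball, so that solutions of a truncated field
    qualify. *)
Lemma region_invariant (x : R -> 'cV[R]_n) :
  (forall t e, 0 <= t -> 0 < e -> exists2 c, 0 < c &
     forall s, 0 <= s -> `|s - t| < c -> `|x s - x t| < e) ->
  (forall t e, 0 <= t -> `|x t - x0| <= r -> 0 < e -> exists2 c, 0 < c &
     forall s, t <= s < t + c -> F (x s) <= F (x t) + e * (s - t)) ->
  `|x 0 - x0| < rho -> w (x 0) -> F (x 0) - F x0 < m ->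
  forall t, 0 <= t -> `|x t - x0| < rho.
Proof.
move=> cx dec xrho wx Fx T T0.
(* Up to time [T], an error of slope [e] in the decrease of [F] is harmless. *)
pose e := (m - (F (x 0) - F x0)) / (T + 1).
have T10 : 0 < T + 1 by lra.
have e0 : 0 < e by rewrite divr_gt0 // subr_gt0.
have eT : e * T < m - (F (x 0) - F x0).
  have : e * (T + 1) = m - (F (x 0) - F x0) by rewrite divfK // gt_eqF.
  by lra.
pose P t := t <= T -> [/\ `|x t - x0| < rho, w (x t) & F (x t) <= F (x 0) + e * t].
have low t : 0 <= t -> t <= T -> F (x t) <= F (x 0) + e * t -> F (x t) - F x0 < m.
  move=> t0 tT; have : e * t <= e * T by rewrite ler_wpM2l // ltW.
  by lra.
have min0 : 0 < Num.min d (r - rho) by rewrite lt_min d0 subr_gt0.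
suff H : forall t, 0 <= t -> P t by case: (H T T0 (lexx T)).
apply: real_induction.
- by move=> _; rewrite mulr0 addr0.
- move=> t t0 Pt; have [tT|Tt] := leP t T; last first.
    by exists 1 => // s /andP[ts _] sT; lra.
  have [tr wt Ft] := Pt tT.
  have [c1 c10 c1P] := cx t _ t0 min0.
  have [c2 c20 c2P] := dec t e t0 (ltW (lt_trans tr rho_r)) e0.
  exists (Num.min c1 c2); first by rewrite lt_min c10.
  move=> s /andP[ts]; rewrite -ltrBlDl lt_min => /andP[s1 s2] sT.
  have [|] := @low_neighbor (x t) (x s) tr wt (low t t0 tT Ft).
    rewrite distrC; apply: c1P; first exact: le_trans ts.
    by rewrite ger0_norm // subr_ge0.
  move=> sr ws; split => //.
  have : F (x s) <= F (x t) + e * (s - t).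
    by apply: c2P; rewrite ts -ltrBlDl.
  by rewrite mulrBr; lra.
(* At a limit time, membership comes from an earlier time one short move away, and the bound on [F]
   from continuity. *)
- move=> t t0 Pt tT.
  have close c : 0 < c -> exists s, [/\ 0 <= s < t, `|s - t| < c & s <= T].
    move=> c0; exists (Num.max 0 (t - c / 2)).
    have c2 : 0 < c / 2 by rewrite divr_gt0.
    have h : Num.max 0 (t - c / 2) < t by rewrite gt_max t0 ltrBlDr ltrDl.
    split.
    + by rewrite le_max lexx.
    + rewrite distrC ger0_norm ?subr_ge0 ?ltW // ltrBlDr -ltrBlDl lt_max.
      by apply/orP; right; lra.
    + exact: le_trans (ltW h) tT.
  have [c1 c10 c1P] := cx t _ (ltW t0) min0.
  have [s [s0t st sT]] := close c1 c10.
  have /andP[s0 _] := s0t.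
  have [sr ws Fs] := Pt s s0t sT.
  have [tr wt] := low_neighbor sr ws (low s s0 sT Fs) (c1P s s0 st).
  split => //; rewrite leNgt; apply/negP => Ft.
  have gap : 0 < F (x t) - (F (x 0) + e * t) by rewrite subr_gt0.
  have /cvgrPdist_lt/(_ _ gap)/nbhs_ballP[q /= q0 qP] :=
    cF (ltW (lt_trans tr rho_r)).
  have [c2 c20 c2P] := cx t _ (ltW t0) q0.
  have [s' [s0t' st' sT']] := close c2 c20.
  have /andP[s0' ts'] := s0t'.
  have [_ _ Fs'] := Pt s' s0t' sT'.
  have /qP : ball (x t) q (x s') by rewrite -ball_normE /= distrC; exact: c2P.
  have : e * s' <= e * t by rewrite ler_wpM2l // ltW.
  by rewrite /= ltr_norml => ? /andP[_ ?]; lra.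
Qed.

End invariance.

(** For [0 <= r], a 1-Lipschitz retraction onto the closed sup-norm ball; composing with it extends
    a continuous field on the ball to a bounded, uniformly continuous one. *)
Definition clamp (R : realType) (n : nat) (x0 : 'cV[R]_n) (r : R)
    (x : 'cV[R]_n) : 'cV[R]_n :=
  \col_i (x0 i 0 + Num.max (- r) (Num.min r (x i 0 - x0 i 0))).

Lemma clamp_ball (R : realType) (n : nat) (x0 : 'cV[R]_n) (r : R)
    (x : 'cV[R]_n) : 0 <= r -> `|clamp x0 r x - x0| <= r.
Proof.
move=> r0; apply: norm_le_coord => // i; rewrite !mxE [x0 i 0 + _]addrC addrK.
by rewrite ler_norml le_max lexx /= ge_max ge_min lexx andbT; lra.
Qed.

Lemma clamp_id (R : realType) (n : nat) (x0 : 'cV[R]_n) (r : R) (x : 'cV[R]_n) :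
  `|x - x0| <= r -> clamp x0 r x = x.
Proof.
move=> xr; apply/colP => i; rewrite mxE.
have := le_trans (norm_coord_le _ i) xr; rewrite !mxE ler_norml => /andP[h1 h2].
by rewrite (min_idPr h2) (max_idPr h1); lra.
Qed.

Lemma clamp_lipschitz (R : realType) (n : nat) (x0 : 'cV[R]_n) (r : R)
    (x y : 'cV[R]_n) : 0 <= r -> `|clamp x0 r x - clamp x0 r y| <= `|x - y|.
Proof.
move=> r0; apply: norm_le_coord => // i; rewrite !mxE.
have := norm_coord_le (x - y) i; rewrite !mxE !ler_norml => /andP[h1 h2].
set u := x i 0 - x0 i 0; set v := y i 0 - x0 i 0.
have uv : x i 0 - y i 0 = u - v by rewrite /u /v; lra.
rewrite uv in h1 h2.
case: (leP r u) => h3; case: (leP r v) => h4; case: (leP (- r) r) => h5;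
  case: (leP (- r) u) => h6; case: (leP (- r) v) => h7; apply/andP; split; lra.
Qed.

Lemma gradient_system_continuous (R : realType) (n : nat) (G : set 'cV[R]_n)
    (F : 'cV[R]_n -> R) (x : 'cV[R]_n) :
  Ck G 1 F -> G x -> {for x, continuous (gradient_system F)}.
Proof.
move=> [_ dF] Gx A /nbhs_ballP[e /= e0 eA].
have : \forall y \near x, forall i, `|partial i F x - partial i F y| < e / 2.
  have e20 : 0 < e / 2 by rewrite divr_gt0.
  apply: (@filter_forall _ _ (fun i y => `|partial i F x - partial i F y| < e / 2)
    (nbhs x)) => i.
  have [_ [cp _]] := dF i.
  by have /cvgrPdist_lt/(_ _ e20) := cp x Gx.
apply: filterS => y H; apply: eA; rewrite -ball_normE /=.
apply: (@le_lt_trans _ _ (e / 2)); last by rewrite gtr_pMr // invf_lt1 // ltr1n.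
apply: norm_le_coord => [|i]; first by rewrite divr_ge0 // ltW.
by rewrite !mxE opprK addrC distrC; exact: ltW.
Qed.

(** * Stability *)

(** Euler's method applies to the truncated field. Its estimate is based at the earlier time; for
    [s < t] the base point is moved from [x s] to [x t] by uniform continuity. *)
Lemma clamped_ode_exists (R : realType) (n : nat) (x0 p : 'cV[R]_n) (r : R)
    (f : 'cV[R]_n -> 'cV[R]_n) : 0 <= r ->
  (forall y, `|y - x0| <= r -> {for y, continuous f}) ->
  exists2 x : R -> 'cV[R]_n, x 0 = p &
    forall t, 0 <= t -> tangent x t (f (clamp x0 r (x t))).
Proof.
move=> r0 cf; set g := fun y => f (clamp x0 r y).
have cB := @compact_closed_ball R n x0 r.
have inB y : `|clamp x0 r y - x0| <= r by exact: clamp_ball.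
(* A lower bound for this inverse is an upper bound for the norm of [f]. *)
have [||b b0 bP] := @compact_lower_bound R _ _ (fun y => (1 + `|f y|)^-1) cB.
- move=> y /cf cfy; apply: (@cvgV _ _ (nbhs y) _ (fun z => 1 + `|f z|)).
    by rewrite gt_eqF // ltr_wpDr.
  by apply: (@cvgD _ _ _ (nbhs y)); [exact: cvg_cst|exact: cvg_norm].
- by move=> y _; rewrite invr_gt0 ltr_wpDr.
have gM y : `|g y| <= b^-1.
  apply: (@le_trans _ _ (1 + `|g y|)); first by rewrite lerDr.
  by rewrite -[leLHS]invrK lef_pV2 ?posrE ?invr_gt0 ?ltr_wpDr //; apply: bP; exact: inB.
have gu e : 0 < e -> exists2 d, 0 < d &
    forall y z, `|y - z| < d -> `|g y - g z| <= e.
  move=> e0; have [d d0 dP] := compact_uniform_continuity cB cf e0.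
  exists d => // y z yz; apply/ltW/dP; first exact: inB.
  exact: le_lt_trans (clamp_lipschitz _ _ _ r0) yz.
have [x xp xP] := @bounded_ode_exists R n g p _ gM gu.
exists x => // t t0 k k0; have k20 : 0 < k / 2 by rewrite divr_gt0.
have [d1 d10 d1P] := xP _ k20; have [d2 d20 d2P] := gu _ k20.
have M0 : 0 < b^-1 + k / 2 by rewrite addr_gt0 // invr_gt0.
exists (Num.min d1 (d2 / (b^-1 + k / 2))); first by rewrite lt_min d10 divr_gt0.
move=> s s0; rewrite lt_min ltr_pdivlMr // => /andP[st1 st2].
have [ts|st] := leP t s.
  have st0 : 0 <= s - t by rewrite subr_ge0.
  move: st1; rewrite ger0_norm // => st1.
  by rewrite (le_trans (d1P t s t0 ts st1)) // ler_wpM2l //; lra.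
have ts0 : 0 <= t - s by rewrite subr_ge0 ltW.
move: st1 st2; rewrite [`|s - t|]distrC (ger0_norm ts0) => st1 st2.
have := d1P s t s0 (ltW st) st1; set q := x t - x s - _ => qk.
have xst : x t - x s = q + (t - s) *: g (x s) by rewrite subrK.
have close : `|x t - x s| < d2.
  apply: le_lt_trans st2; rewrite xst (le_trans (ler_normD _ _)) //.
  rewrite mulrDr [leRHS]addrC lerD //.
  by rewrite normrZ (ger0_norm ts0) ler_wpM2l.
have -> : x s - x t - (s - t) *: f (clamp x0 r (x t)) =
    - q + (t - s) *: (g (x t) - g (x s)).
  rewrite -[x s - x t]opprB xst -/(g (x t)) -[s - t]opprB scaleNr opprK.
  by rewrite scalerBr opprD -addrA; congr (_ + _); rewrite addrC.
rewrite (le_trans (ler_normD _ _)) // normrN normrZ (ger0_norm ts0).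
have -> : (t - s) * k = (t - s) * (k / 2) + (t - s) * (k / 2) by lra.
by rewrite lerD // ler_wpM2l // d2P.
Qed.

(** A solution of the clamped system started near [x0] stays in the [rho]-ball, where [clamp] is the
    identity, so it is a global solution of the gradient system. The same invariance confines every
    solution. *)
Lemma stable_in_region (R : realType) (n : nat) (G : set 'cV[R]_n)
    (F : 'cV[R]_n -> R) (x0 : 'cV[R]_n) (rho r d m : R) (w : 'cV[R]_n -> bool) :
  open G -> Ck G 1 F -> (forall y, `|y - x0| <= r -> G y) ->
  0 < rho -> rho < r -> 0 < d -> 0 < m -> w x0 ->
  (forall y, rho <= `|y - x0| <= r -> ~~ w y) ->
  (forall y z, `|y - x0| <= r -> `|z - x0| <= r -> `|y - z| < d ->
    w y != w z -> m <= F y - F x0) ->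
  exists2 delta, 0 < delta & forall p, `|p - x0| < delta ->
    (exists2 x, solution G (gradient_system F) x & x 0 = p) /\
    (forall x, solution G (gradient_system F) x -> x 0 = p ->
       forall t, 0 <= t -> `|x t - x0| < rho).
Proof.
move=> oG hF rG rho0 rhor d0 m0 wx0 wsh wcross.
have r0 : 0 <= r by rewrite ltW // (lt_trans rho0).
have cF y : `|y - x0| <= r -> {for y, continuous F}.
  by move=> /rG; case: hF => + _; apply.
have x0r : `|x0 - x0| <= r by rewrite subrr normr0.
have /cvgrPdist_lt/(_ _ m0)/nbhs_ballP[q /= q0 qP] := cF x0 x0r.
have min0 : 0 < Num.min d (r - rho) by rewrite lt_min d0 subr_gt0.
(* [q] makes [F p] less than [F x0 + m]; the other two bounds put [p] in [w] by [low_neighbor] at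
   [x0]. *)
exists (Num.min q (Num.min d (r - rho))); first by rewrite lt_min q0.
move=> p; rewrite lt_min => /andP[pq pd].
have [||||prho wp] := @low_neighbor R n x0 rho r d m F w rhor wsh wcross x0 p.
- by rewrite subrr normr0.
- by [].
- by rewrite subrr.
- by rewrite distrC.
have Fp : F p - F x0 < m.
  have /qP : ball x0 q p by rewrite -ball_normE /= distrC.
  by rewrite /= ltr_norml => /andP[? _]; lra.
have inv (x : R -> 'cV[R]_n) : x 0 = p ->
    (forall t, 0 <= t -> exists v, tangent x t v) ->
    (forall t, 0 <= t -> `|x t - x0| <= r -> tangent x t (gradient_system F (x t))) ->
    forall t, 0 <= t -> `|x t - x0| < rho.
  move=> xp xt xg; apply: (region_invariant rhor d0 cF wsh wcross).
  - by move=> t e t0 e0; have [v /tangent_continuous] := xt t t0; apply.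
  - move=> t e t0 xr e0; apply: (gradient_descent oG hF) => //; first exact: rG.
    exact: xg.
  - by rewrite xp.
  - by rewrite xp.
  - by rewrite xp.
split.
  have [|x xp xt] := @clamped_ode_exists R n x0 p r (gradient_system F) r0.
    by move=> y /rG; exact: gradient_system_continuous.
  have xin : forall t, 0 <= t -> `|x t - x0| < rho.
    apply: inv => // t t0; first by exists (gradient_system F (clamp x0 r (x t))); exact: xt.
    by move=> xr; have := xt t t0; rewrite clamp_id.
  exists x => // t t0; have xr := ltW (lt_trans (xin t t0) rhor).
  split; first exact: rG.
  by apply/tangentP; have := xt t t0; rewrite clamp_id.
move=> x sx xp; apply: inv => // t t0; have [_ /tangentP xt] := sx t t0.
  by exists (gradient_system F (x t)).
by move=> _.
Qed.

Lemma norm_le_enorm (R : realType) (n : nat) (v : 'cV[R]_n) : `|v| <= enorm v.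
Proof.
apply: norm_le_coord => [|i]; first exact: sqrtr_ge0.
rewrite -sqrtr_sqr ler_wsqrtr // (bigD1 i) //= lerDl.
by apply: sumr_ge0 => j _; exact: sqr_ge0.
Qed.

Lemma enorm_le_norm (R : realType) (n : nat) (v : 'cV[R]_n) :
  enorm v <= Num.sqrt n%:R * `|v|.
Proof.
have -> : `|v| = Num.sqrt (`|v| ^+ 2) by rewrite sqrtr_sqr normr_id.
rewrite -sqrtrM // ler_wsqrtr // mulr_natl -[X in _ *+ X]card_ord -sumr_const.
apply: ler_sum => i _; rewrite -real_normK ?num_real //.
by rewrite lerXn2r ?nnegrE // norm_coord_le.
Qed.

Lemma Ck_C1 (R : realType) (n k : nat) (G : set 'cV[R]_n) (F : 'cV[R]_n -> R) :
  (1 <= k)%N -> Ck G k F -> Ck G 1 F.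
Proof.
case: k => // k _ [cF dF]; split=> // i; have [d c] := dF i.
by split=> //; split=> //; case: k {dF} c => [|k] [].
Qed.

Lemma partialN (R : realType) (n : nat) (F : 'cV[R]_n -> R) (i : 'I_n)
    (x : 'cV[R]_n) : derivable F x (delta_mx i 0) ->
  partial i (fun y => - F y) x = - partial i F x.
Proof. exact: deriveN. Qed.

Lemma C1N (R : realType) (n : nat) (G : set 'cV[R]_n) (F : 'cV[R]_n -> R) :
  open G -> Ck G 1 F -> Ck G 1 (fun x => - F x).
Proof.
move=> oG [cF dF]; split; first by move=> x /cF ?; exact: (@cvgN _ _ _ (nbhs x)).
move=> i; have [dFi [cFi _]] := dF i; split.
  by move=> x Gx; apply: derivableN; exact: dFi.
split=> // x Gx.
have E : \forall y \near x, - partial i F y = partial i (fun x => - F x) y.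
  have : nbhs x G by exact: open_nbhs_nbhs.
  by apply: filterS => y Gy; rewrite partialN //; exact: dFi.
have : partial i (fun x => - F x) @ x --> - partial i F x.
  apply: cvg_trans; first exact: near_eq_cvg E.
  by apply: (@cvgN _ _ _ (nbhs x)); exact: cFi.
by rewrite -(partialN (dFi x Gx)).
Qed.

(** Stability for a single [eps], isolated because the sign of [F] that works may at first depend on
    [eps]. *)
Definition orbits_within (R : realType) (n : nat) (G : set 'cV[R]_n)
    (f : 'cV[R]_n -> 'cV[R]_n) (x0 : 'cV[R]_n) (eps : R) : Prop :=
  exists2 delta : R, 0 < delta &
    forall p : 'cV[R]_n, enorm (p - x0) < delta ->
      (exists2 x : R -> 'cV[R]_n, solution G f x & x 0 = p) /\
      (forall x : R -> 'cV[R]_n, solution G f x -> x 0 = p ->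
         forall t : R, 0 <= t -> enorm (x t - x0) < eps).

Lemma enorm0 (R : realType) (n : nat) : enorm (0 : 'cV[R]_n) = 0.
Proof. by rewrite /enorm big1 ?sqrtr0 // => i _; rewrite mxE expr0n. Qed.

(* If all orbits from [x0] stay arbitrarily close to [x0], then the orbit of
   [x0], which exists, is constant. *)
Lemma orbits_within_stable (R : realType) (n : nat) (G : set 'cV[R]_n)
    (f : 'cV[R]_n -> 'cV[R]_n) (x0 : 'cV[R]_n) : G x0 ->
  (forall eps, 0 < eps -> orbits_within G f x0 eps) -> lyapunov_stable G f x0.
Proof.
move=> Gx0 H; split; last exact: H.
split => //.
have x0x0 (delta : R) : 0 < delta -> enorm (x0 - x0) < delta by rewrite subrr enorm0.
have [d d0 /(_ x0 (x0x0 _ d0))[[x sx xx0] _]] := H 1 ltr01.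
have const t : 0 <= t -> x t = x0.
  move=> t0; apply/eqP; rewrite -subr_eq0 -normr_eq0 eq_le normr_ge0 andbT.
  apply/ler_addgt0Pl => e e0; rewrite addr0.
  have [d' d'0 /(_ x0 (x0x0 _ d'0))[_ /(_ x sx xx0 t t0)]] := H e e0.
  by move=> /ltW; apply: le_trans; exact: norm_le_enorm.
have [_ /tangentP x't] := sx 0 (lexx 0).
apply/eqP; rewrite -normr_eq0 eq_le normr_ge0 andbT.
apply/ler_addgt0Pl => e e0; rewrite addr0.
have [c c0 cP] := x't e e0.
have c20 : 0 < c / 2 by rewrite divr_gt0.
have c2c : `|c / 2 - 0| < c by rewrite subr0 gtr0_norm //; lra.
have := cP (c / 2) (ltW c20) c2c; rewrite (const _ (ltW c20)) (const 0 (lexx 0)).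
by rewrite subrr sub0r normrN normrZ subr0 gtr0_norm // ler_pM2l.
Qed.

(** For each [eps] one of the two signs works. If [F] fails at some [e1], it fails at every smaller
    bound, so [- F] works at the minimum of [eps] and [e1], hence at [eps]. *)
Lemma isolated_level_point_stable (R : realType) (n : nat) (G : set 'cV[R]_n)
    (F : 'cV[R]_n -> R) (x0 : 'cV[R]_n) (r : R) :
  (2 <= n)%N -> open G -> Ck G 1 F -> 0 < r ->
  (forall y, `|y - x0| <= r -> G y) ->
  quasi_component [set x | `|x - x0| <= r /\ F x = F x0] x0 `<=` [set x0] ->
  lyapunov_stable G (gradient_system F) x0 \/
  lyapunov_stable G (gradient_system (fun x => - F x)) x0.
Proof.
move=> n2 oG C1F r0 rG Q1.
have Gx0 : G x0 by apply: rG; rewrite subrr normr0 ltW.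
have cF y : `|y - x0| <= r -> {for y, continuous F}.
  by move=> /rG; case: C1F => + _; apply.
have sn0 : 0 < Num.sqrt n%:R :> R by rewrite sqrtr_gt0 ltr0n (ltn_trans _ n2).
have one eps : 0 < eps -> orbits_within G (gradient_system F) x0 eps \/
    orbits_within G (gradient_system (fun x => - F x)) x0 eps.
  move=> eps0; pose rho := Num.min (r / 2) (eps / Num.sqrt n%:R).
  have rho0 : 0 < rho by rewrite lt_min !divr_gt0.
  have rhor : rho < r.
    by apply: (@le_lt_trans _ _ (r / 2)); [rewrite ge_min lexx|lra].
  have within H : (exists2 delta, 0 < delta & forall p, `|p - x0| < delta ->
      (exists2 x, solution G (gradient_system H) x & x 0 = p) /\
      (forall x, solution G (gradient_system H) x -> x 0 = p ->
         forall t, 0 <= t -> `|x t - x0| < rho)) ->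
      orbits_within G (gradient_system H) x0 eps.
    move=> [delta delta0 dP]; exists delta => // p pd.
    have [|ex all] := dP p; first exact: le_lt_trans (norm_le_enorm _) pd.
    split=> // x sx xp t t0; apply: le_lt_trans (enorm_le_norm _) _.
    have := all x sx xp t t0; rewrite lt_min => /andP[_].
    by rewrite ltr_pdivlMr // mulrC.
  (* If the sign bit is true, [F] is below [F x0] at the crossings, so [- F] is above its value at
     [x0] there and its descent is blocked. *)
  have [w [[] [d [m [d0 m0 wx0 wsh wP]]]]] :=
    isolated_separation n2 rho0 (ltW rhor) cF Q1.
  - right; apply: within.
    apply: (@stable_in_region _ _ _ _ x0 rho r d m w) => //; first exact: C1N.
    move=> y z yr zr yz wyz; have := wP y z yr zr yz wyz.
    by rewrite expr1 mulN1r opprB addrC opprK.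
  - left; apply: within.
    apply: (@stable_in_region _ _ _ _ x0 rho r d m w) => //.
    move=> y z yr zr yz wyz; have := wP y z yr zr yz wyz.
    by rewrite expr0 mul1r.
have mono f (e1 e2 : R) : e1 <= e2 -> orbits_within G f x0 e1 -> orbits_within G f x0 e2.
  move=> e12 [delta delta0 dP]; exists delta => // p /dP[ex all]; split=> // x sx xp t t0.
  exact: lt_le_trans (all x sx xp t t0) e12.
have [H|/existsNP[e1 /not_implyP[e10 nH]]] :=
  pselect (forall eps, 0 < eps -> orbits_within G (gradient_system F) x0 eps).
  by left; exact: orbits_within_stable.
right; apply: orbits_within_stable => // eps eps0.
have [|H|] := one (Num.min eps e1); first by rewrite lt_min eps0.
  by exfalso; apply: nH; apply: mono H; rewrite ge_min lexx orbT.
by apply: mono; rewrite ge_min lexx.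
Qed.

Unset Implicit Arguments.

Theorem theorem4p2 (R : realType) (n : nat) (hn : (2 <= n)%N)
    (G : set 'cV[R]_n) (hG : domain G)
    (F : 'cV[R]_n -> R) (hF : Ck G n F)
    (x0 : 'cV[R]_n) (hx0 : G x0)
    (hcomp : connected_component (G `&` F @^-1` [set F x0]) x0 = [set x0]) :
  lyapunov_stable G (gradient_system F) x0 \/
  lyapunov_stable G (gradient_system (fun x => - F x)) x0.
Proof.
have [_ oG _] := hG.
have C1F : Ck G 1 F by apply: Ck_C1 hF; exact: ltnW.
have [r r0 rG] : exists2 r, 0 < r & forall y, `|y - x0| <= r -> G y.
  have /nbhs_ballP[r /= r0 rG] : nbhs x0 G by exact: open_nbhs_nbhs.
  exists (r / 2) => [|y yr]; first by rewrite divr_gt0.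
  by apply: rG; rewrite -ball_normE /= distrC; lra.
have cF y : `|y - x0| <= r -> {for y, continuous F}.
  by move=> /rG; case: C1F => + _; apply.
(* The quasi-component is a connected part of the level set containing [x0], so it lies in the
   component [{x0}]. *)
have Q1 : quasi_component [set x | `|x - x0| <= r /\ F x = F x0] x0 `<=` [set x0].
  have cZ := @compact_level R n x0 r (F x0) F cF.
  have Zx0 : `|x0 - x0| <= r /\ F x0 = F x0 by rewrite subrr normr0 ltW.
  rewrite -hcomp; apply: connected_component_max.
  - by move=> eta _; exact: reach_refl.
  - move=> x /(_ 1 ltr01)/(reach_mem Zx0)[xr Fx]; split => //.
    exact: rG.
  - exact: quasi_component_connected.
exact: isolated_level_point_stable hn oG C1F r0 rG Q1.
Qed.
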